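(* Let Assumption (A1) hold and let $P_{\rm joint}=\begin{pmatrix}P_1&P_{12}\\P_{12}^\top&P_2\end{pmatrix}\succ0$ with $P_1\in\mathbb R^{p_1\times p_1}$, $P_2\in\mathbb R^{p_2\times p_2}$, $P_{12}\in\mathbb R^{p_1\times p_2}$. Consider the set $$\mathcal P:=\{KP_{\rm joint}K^\top : K\in\mathbb R^{n\times(p_1+p_2)},\ KH=I\}$$ of error covariances of unbiased linear fused estimators. The set $\mathcal P$ contains a unique minimal element $P^\ast=K^\ast P_{\rm joint}(K^\ast)^\top$ with respect to the Löwner order, and $K^\ast$ and $P^\ast$ can be computed as $$K^\ast=(H^\top P_{\rm joint}^{-1}H)^{-1}H^\top P_{\rm joint}^{-1},\qquad P^\ast=(H^\top P_{\rm joint}^{-1}H)^{-1}.$$ Furthermore, $(P^\ast)^{-1}\succeq H_1^\top P_1^{-1}H_1$ and $(P^\ast)^{-1}\succeq H_2^\top P_2^{-1}H_2$.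
   Context: $n,p_1,p_2$ are positive integers, $p_1,p_2\le n$, $H_1\in\mathbb R^{p_1\times n}$, $H_2\in\mathbb R^{p_2\times n}$, $H=\begin{pmatrix}H_1\\H_2\end{pmatrix}$. Assumption (A1): $\mathrm{rk}(H_1)=p_1$, $\mathrm{rk}(H_2)=p_2$, $\mathrm{rk}(H)=n$, and $\hat x_1,\hat x_2$ are unbiased estimators of $H_1x_{\rm true}$, $H_2x_{\rm true}$ for an unknown $x_{\rm true}\in\mathbb R^n$ (with joint error covariance $P_{\rm joint}$; the estimators $K_1\hat x_1+K_2\hat x_2$ with $K=\begin{pmatrix}K_1&K_2\end{pmatrix}$ are unbiased for all $x_{\rm true}$ iff $KH=I$, and then have error covariance $KP_{\rm joint}K^\top$). $\preceq$ denotes the Löwner order on symmetric matrices. A minimal element of $\mathcal P$ with respect to the Löwner order is an element $P^\ast\in\mathcal P$ with $P\succeq P^\ast$ for all $P\in\mathcal P$. *)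

(* Defs.v *)
From HB Require Import structures.
From mathcomp Require Import all_boot all_order all_algebra.
From mathcomp Require Import all_classical all_reals all_analysis.

Set Implicit Arguments.
Unset Strict Implicit.
Unset Printing Implicit Defensive.

Import Order.TTheory GRing.Theory Num.Theory.
Local Open Scope classical_set_scope.
Local Open Scope ring_scope.

Definition symmetric_mx (R : realType) (n : nat) (A : 'M[R]_n) : Prop :=
  A^T = A.

Definition psd_mx (R : realType) (n : nat) (A : 'M[R]_n) : Prop :=
  symmetric_mx A /\ forall v : 'cV[R]_n, 0 <= (v^T *m A *m v) 0 0.

Definition posdef_mx (R : realType) (n : nat) (A : 'M[R]_n) : Prop :=
  symmetric_mx A /\
  forall v : 'cV[R]_n, v != 0 -> 0 < (v^T *m A *m v) 0 0.

(* The Loewner order, an order on symmetric matrices only: [loewner_le A B]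
   includes the symmetry of both arguments. *)
Definition loewner_le (R : realType) (n : nat) (A B : 'M[R]_n) : Prop :=
  [/\ symmetric_mx A, symmetric_mx B & psd_mx (B - A)].

(* "Minimal" here means below every element of [S], not merely having no
   element of [S] strictly below. *)
Definition loewner_minimal (R : realType) (n : nat) (S : set 'M[R]_n)
    (M : 'M[R]_n) : Prop :=
  S M /\ forall A : 'M[R]_n, S A -> loewner_le M A.

(* The law of the data depends on the unknown true state: [Pr x] is the
   probability measure when the true state is [x].  An estimator is a random
   vector that does not depend on [x]; the two notions below quantify over all
   [x].  Membership in [Lfun] provides measurability and the finiteness of the
   moments involved. *)
Definition unbiased_estimator (d : measure_display) (T : measurableType d)
    (R : realType) (n p : nat) (Pr : 'cV[R]_n -> probability T R)
    (H : 'M[R]_(p, n)) (xhat : T -> 'cV[R]_p) : Prop :=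
  forall (x : 'cV[R]_n) (i : 'I_p),
    (fun w => xhat w i 0) \in Lfun (Pr x) 1%E /\
    expectation (Pr x) (fun w => xhat w i 0) = ((H *m x) i 0)%:E.

Definition has_error_covariance (d : measure_display) (T : measurableType d)
    (R : realType) (n p : nat) (Pr : 'cV[R]_n -> probability T R)
    (H : 'M[R]_(p, n)) (xhat : T -> 'cV[R]_p) (C : 'M[R]_p) : Prop :=
  forall x : 'cV[R]_n,
    let err := fun (i : 'I_p) (w : T) => (xhat w - H *m x) i 0 in
    (forall i : 'I_p, err i \in Lfun (Pr x) 2%:E) /\
    (forall i j : 'I_p, covariance (Pr x) (err i) (err j) = (C i j)%:E).

(* K *m H = 1%:M is the unbiasedness of the fused estimator
   K *m col_mx xhat1 xhat2. *)
Definition fused_covariances (R : realType) (n q : nat)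
    (H : 'M[R]_(q, n)) (P : 'M[R]_q) : set 'M[R]_n :=
  [set C | exists K : 'M[R]_(n, q), K *m H = 1%:M /\ C = K *m P *m K^T].

(* Main.v *)
Require Import Defs.
From HB Require Import structures.
From mathcomp Require Import all_boot all_order all_algebra.
From mathcomp Require Import all_classical all_reals all_analysis.

Set Implicit Arguments.
Unset Strict Implicit.
Unset Printing Implicit Defensive.

Import Order.TTheory GRing.Theory Num.Theory.
Local Open Scope classical_set_scope.
Local Open Scope ring_scope.

(** The result is the Gauss-Markov theorem for the observation matrix [H] and
    the noise covariance [P].  Write [S := H^T P^-1 H] for the information
    matrix and [K* := S^-1 H^T P^-1]; [S] is invertible because [P^-1] is positive
    definite and [H] is injective.  Any [K] with [K H = I] differs from [K*]
    by a matrix [D] with [D H = 0], and [D P K*^T = D H S^-1 = 0]: the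
    deviation is uncorrelated with the best estimator.  The covariances then
    add up as in Pythagoras' theorem, [K P K^T = S^-1 + D P D^T], so that
    [S^-1] lies below every fused covariance ([fused_covariance_excess]).
    Uniqueness is the antisymmetry of the Loewner order.

    The two final inequalities say that forgetting data cannot create
    information.  If only [L xhat] is kept, the observation matrix becomes
    [L H] and the covariance [L P L^T], and the information matrix decreases
    ([information_compression_le]); keeping one of the two blocks of [xhat]
    turns these into [H1], [P1] or [H2], [P2].  The point is that
    [W := P^-1 - L^T (L P L^T)^-1 L] satisfies [W = W P W^T], hence is positive
    semidefinite. *)


(** * Quadratic forms *)

Lemma quad_congr (R : realType) (m n : nat) (M : 'M[R]_(m, n)) (A : 'M[R]_m)
    (v : 'cV[R]_n) :
  v^T *m (M^T *m A *m M) *m v = (M *m v)^T *m A *m (M *m v).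
Proof. by rewrite trmx_mul !mulmxA. Qed.

Lemma symmetric_congr (R : realType) (m n : nat) (M : 'M[R]_(m, n))
    (A : 'M[R]_m) :
  symmetric_mx A -> symmetric_mx (M^T *m A *m M).
Proof. by move=> sA; rewrite /symmetric_mx !trmx_mul trmxK sA mulmxA. Qed.

Lemma symmetric_inv (R : realType) (n : nat) (A : 'M[R]_n) :
  symmetric_mx A -> symmetric_mx (invmx A).
Proof. by move=> sA; rewrite /symmetric_mx trmx_inv sA. Qed.

Lemma posdef_psd (R : realType) (n : nat) (A : 'M[R]_n) :
  posdef_mx A -> psd_mx A.
Proof.
move=> [sA pA]; split=> // v; have [->|/pA/ltW //] := eqVneq v 0.
by rewrite mulmx0 mxE.
Qed.

Lemma psd_congr (R : realType) (m n : nat) (M : 'M[R]_(m, n)) (A : 'M[R]_m) :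
  psd_mx A -> psd_mx (M^T *m A *m M).
Proof.
move=> [sA pA]; split; first exact: symmetric_congr.
by move=> v; rewrite quad_congr.
Qed.

Lemma posdef_congr (R : realType) (m n : nat) (M : 'M[R]_(m, n))
    (A : 'M[R]_m) :
  row_full M -> posdef_mx A -> posdef_mx (M^T *m A *m M).
Proof.
move=> /row_fullP[B BM] [sA pA]; split; first exact: symmetric_congr.
move=> v v0; rewrite quad_congr; apply: pA; apply: contraNneq v0 => Mv0.
by rewrite -[v]mul1mx -BM -mulmxA Mv0 mulmx0.
Qed.

Lemma posdef_unitmx (R : realType) (n : nat) (A : 'M[R]_n) :
  posdef_mx A -> A \in unitmx.
Proof.
move=> [_ pA]; rewrite -row_free_unit -kermx_eq0; apply/rowV0P => u.
move=> /sub_kermxP uA0; apply/eqP; apply: contraT => u0.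
have := pA u^T; rewrite trmxK uA0 mul0mx mxE ltxx.
by rewrite -trmx0 (inj_eq trmx_inj) => /(_ u0).
Qed.

Lemma posdef_inv (R : realType) (n : nat) (A : 'M[R]_n) :
  posdef_mx A -> posdef_mx (invmx A).
Proof.
move=> pA; have uA := posdef_unitmx pA.
have -> : invmx A = (invmx A)^T *m A *m invmx A.
  by rewrite (symmetric_inv pA.1) mulVmx // mul1mx.
by apply: posdef_congr => //; rewrite row_full_unit unitmx_inv.
Qed.

(** * Antisymmetry of the Loewner order *)

(** Polarization: the form of [A] at [e_i + e_j] is the sum of its values at
    [e_i] and [e_j] and of [2 A_ij]. *)
Lemma symmetric_quad_eq0 (R : realType) (n : nat) (A : 'M[R]_n) :
  symmetric_mx A -> (forall v : 'cV[R]_n, (v^T *m A *m v) 0 0 = 0) -> A = 0.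
Proof.
move=> sA qA; apply/matrixP => i j; rewrite [RHS]mxE.
have form k l :
    ((delta_mx k 0 : 'cV[R]_n)^T *m A *m (delta_mx l 0 : 'cV[R]_n)) 0 0 = A k l.
  by rewrite trmx_delta -rowE -colE !mxE.
have := qA (delta_mx i 0 + delta_mx j 0).
rewrite [(_ + _)^T]linearD /= !mulmxDl !mulmxDr.
rewrite [X in X = 0]mxE [X in X + _ = 0]mxE [X in _ + X = 0]mxE.
rewrite !form.
have Aii : A i i = 0 by rewrite -form qA.
have Ajj : A j j = 0 by rewrite -form qA.
have Aji : A j i = A i j by rewrite -{1}sA mxE.
rewrite Aii Ajj Aji add0r addr0 -mulr2n => /eqP.
by rewrite mulrn_eq0 /= => /eqP.
Qed.

Lemma loewner_le_anti (R : realType) (n : nat) (A B : 'M[R]_n) :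
  loewner_le A B -> loewner_le B A -> A = B.
Proof.
move=> [_ _ [sBA pBA]] [_ _ [_ pAB]]; apply/esym/eqP; rewrite -subr_eq0.
apply/eqP; apply: symmetric_quad_eq0 => // v; apply/eqP.
rewrite eq_le pBA andbT -oppr_ge0 -(opprB A B) mulmxN mulNmx.
by rewrite [X in - X]mxE opprK.
Qed.

(** * The Gauss-Markov theorem *)

Definition information (R : realType) (q n : nat) (H : 'M[R]_(q, n))
    (P : 'M[R]_q) : 'M[R]_n :=
  H^T *m invmx P *m H.

Definition best_gain (R : realType) (q n : nat) (H : 'M[R]_(q, n))
    (P : 'M[R]_q) : 'M[R]_(n, q) :=
  invmx (information H P) *m H^T *m invmx P.

Lemma information_posdef (R : realType) (q n : nat) (H : 'M[R]_(q, n))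
    (P : 'M[R]_q) :
  row_full H -> posdef_mx P -> posdef_mx (information H P).
Proof. by move=> fH /posdef_inv; apply: posdef_congr. Qed.

Lemma best_gain_unbiased (R : realType) (q n : nat) (H : 'M[R]_(q, n))
    (P : 'M[R]_q) :
  information H P \in unitmx -> best_gain H P *m H = 1%:M.
Proof.
by move=> uS; rewrite -(mulVmx uS) /best_gain /information !mulmxA.
Qed.

(** This is what makes a deviation [D] with [D H = 0] uncorrelated with the
    best estimator: [D P K*^T] factors through [D H]. *)
Lemma mul_cov_best_gainT (R : realType) (q n : nat) (H : 'M[R]_(q, n))
    (P : 'M[R]_q) :
  symmetric_mx P -> P \in unitmx ->
  P *m (best_gain H P)^T = H *m invmx (information H P).
Proof.
move=> sP uP; have sS : symmetric_mx (information H P).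
  exact: symmetric_congr (symmetric_inv sP).
rewrite /best_gain !trmx_mul trmxK (symmetric_inv sP) (symmetric_inv sS).
by rewrite mulKVmx.
Qed.

Lemma best_gain_cov (R : realType) (q n : nat) (H : 'M[R]_(q, n))
    (P : 'M[R]_q) :
  symmetric_mx P -> P \in unitmx -> information H P \in unitmx ->
  best_gain H P *m P *m (best_gain H P)^T = invmx (information H P).
Proof.
move=> sP uP uS; rewrite -mulmxA mul_cov_best_gainT // mulmxA.
by rewrite best_gain_unbiased // mul1mx.
Qed.

(** Pythagoras' theorem for the inner product given by [P]: the cross terms
    vanish because [(K - K* ) H = 0]. *)
Lemma fused_covariance_excess (R : realType) (q n : nat) (H : 'M[R]_(q, n))
    (P : 'M[R]_q) (K : 'M[R]_(n, q)) :
  symmetric_mx P -> P \in unitmx -> information H P \in unitmx ->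
  K *m H = 1%:M ->
  K *m P *m K^T - invmx (information H P) =
  (K - best_gain H P) *m P *m (K - best_gain H P)^T.
Proof.
move=> sP uP uS KH; set D := K - best_gain H P.
have KE : K = D + best_gain H P by rewrite subrK.
have DPK : D *m P *m (best_gain H P)^T = 0.
  rewrite -mulmxA mul_cov_best_gainT // mulmxA /D mulmxBl KH.
  by rewrite best_gain_unbiased // subrr mul0mx.
have KPD : best_gain H P *m P *m D^T = 0.
  by have := congr1 trmx DPK; rewrite trmx0 trmx_mul trmxK trmx_mul sP mulmxA.
rewrite [in LHS]KE [(_ + _)^T]linearD /= mulmxDl mulmxDl !mulmxDr DPK KPD.
by rewrite best_gain_cov // addr0 add0r addrK.
Qed.

Lemma gauss_markov (R : realType) (q n : nat) (H : 'M[R]_(q, n))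
    (P : 'M[R]_q) :
  row_full H -> posdef_mx P ->
  loewner_minimal (fused_covariances H P) (invmx (information H P)).
Proof.
move=> fH pP; have uP := posdef_unitmx pP.
have pS := information_posdef fH pP; have uS := posdef_unitmx pS.
have psd_cov (M : 'M[R]_(n, q)) : psd_mx (M *m P *m M^T).
  by have := psd_congr M^T (posdef_psd pP); rewrite trmxK.
split=> [|_ [K [KH ->]]].
  exists (best_gain H P); split; first exact: best_gain_unbiased.
  by rewrite best_gain_cov //; exact: pP.1.
split; [exact: (posdef_inv pS).1|exact: (psd_cov K).1|].
by rewrite fused_covariance_excess //; exact: pP.1.
Qed.

(** * Information decreases when data are discarded *)

(** The reason is the identity [W = W P W^T] for
    [W := P^-1 - L^T (L P L^T)^-1 L].  Full row rank of [L] makes [L P L^T]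
    invertible. *)
Lemma information_compression_le (R : realType) (p q n : nat)
    (H : 'M[R]_(q, n)) (P : 'M[R]_q) (L : 'M[R]_(p, q)) :
  row_full L^T -> posdef_mx P ->
  loewner_le (information (L *m H) (L *m P *m L^T)) (information H P).
Proof.
move=> fL pP; have uP := posdef_unitmx pP.
have pQ : posdef_mx (L *m P *m L^T).
  by have := posdef_congr fL pP; rewrite trmxK.
have uQ := posdef_unitmx pQ.
split; [exact: symmetric_congr (posdef_inv pQ).1
       |exact: symmetric_congr (posdef_inv pP).1|].
set Q := L *m P *m L^T in pQ uQ *.
pose C := L^T *m invmx Q *m L; pose W := invmx P - C.
have -> : information H P - information (L *m H) Q = H^T *m W *m H.
  by rewrite /W mulmxBr mulmxBl /information /C trmx_mul !mulmxA.
have CPC : C *m P *m C = C.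
  have -> : C *m P *m C = L^T *m (invmx Q *m Q) *m invmx Q *m L.
    by rewrite /C /Q !mulmxA.
  by rewrite mulVmx // mulmx1.
have sC : symmetric_mx C by apply: symmetric_congr; exact: (posdef_inv pQ).1.
have sW : W^T = W by rewrite /W linearB /= (posdef_inv pP).1 sC.
have WE : W = W^T *m P *m W.
  rewrite sW /W !mulmxBr !mulmxBl CPC mulVmx // !mul1mx.
  by rewrite -[C *m P *m invmx P]mulmxA mulmxV // mulmx1 subrr subr0.
by rewrite WE; do 2!apply: psd_congr; exact: posdef_psd.
Qed.

Theorem theorem10 (R : realType) (n p1 p2 : nat)
    (hn : (0 < n)%N) (hp1 : (0 < p1)%N) (hp2 : (0 < p2)%N)
    (hp1n : (p1 <= n)%N) (hp2n : (p2 <= n)%N)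
    (H1 : 'M[R]_(p1, n)) (H2 : 'M[R]_(p2, n))
    (hH1 : \rank H1 = p1) (hH2 : \rank H2 = p2)
    (hH : \rank (col_mx H1 H2) = n)
    (P1 : 'M[R]_p1) (P12 : 'M[R]_(p1, p2)) (P2 : 'M[R]_p2)
    (hP : posdef_mx (block_mx P1 P12 P12^T P2))
    (d : measure_display) (T : measurableType d)
    (Pr : 'cV[R]_n -> probability T R)
    (xhat1 : T -> 'cV[R]_p1) (xhat2 : T -> 'cV[R]_p2)
    (hx1 : unbiased_estimator Pr H1 xhat1)
    (hx2 : unbiased_estimator Pr H2 xhat2)
    (hcov : has_error_covariance Pr (col_mx H1 H2)
              (fun w => col_mx (xhat1 w) (xhat2 w))
              (block_mx P1 P12 P12^T P2)) :
  let H := col_mx H1 H2 in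
  let Pjoint := block_mx P1 P12 P12^T P2 in
  [/\ Pjoint \in unitmx, P1 \in unitmx, P2 \in unitmx &
      H^T *m invmx Pjoint *m H \in unitmx] /\
  exists (Kstar : 'M[R]_(n, p1 + p2)) (Pstar : 'M[R]_n),
    [/\ unique (loewner_minimal (fused_covariances H Pjoint)) Pstar,
        Kstar *m H = 1%:M /\ Pstar = Kstar *m Pjoint *m Kstar^T,
        Kstar = invmx (H^T *m invmx Pjoint *m H) *m H^T *m invmx Pjoint /\
        Pstar = invmx (H^T *m invmx Pjoint *m H),
        Pstar \in unitmx &
        loewner_le (H1^T *m invmx P1 *m H1) (invmx Pstar) /\
        loewner_le (H2^T *m invmx P2 *m H2) (invmx Pstar)].
Proof.
move=> H Pjoint; have fH : row_full H by rewrite /row_full hH.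
have uP := posdef_unitmx hP; have pS := information_posdef fH hP.
have uS := posdef_unitmx pS; have min_P := gauss_markov fH hP.
(* Compressing by L1 or L2 keeps one of the two estimates and turns H, Pjoint
   into H1, P1 or H2, P2. *)
pose L1 : 'M[R]_(p1, p1 + p2) := row_mx 1%:M 0.
pose L2 : 'M[R]_(p2, p1 + p2) := row_mx 0 1%:M.
have fL1 : row_full L1^T.
  apply/row_fullP; exists L1.
  by rewrite tr_row_mx mul_row_col trmx1 mulmx1 mul0mx addr0.
have fL2 : row_full L2^T.
  apply/row_fullP; exists L2.
  by rewrite tr_row_mx mul_row_col trmx1 mulmx1 mul0mx add0r.
have L1P : L1 *m Pjoint *m L1^T = P1.
  rewrite tr_row_mx mul_row_block mul_row_col trmx0 trmx1.
  by rewrite !mul1mx !mul0mx !mulmx0 mulmx1 !addr0.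
have L2P : L2 *m Pjoint *m L2^T = P2.
  rewrite tr_row_mx mul_row_block mul_row_col trmx0 trmx1.
  by rewrite !mul1mx !mul0mx !mulmx0 mulmx1 !add0r.
have L1H : L1 *m H = H1 by rewrite mul_row_col mul1mx mul0mx addr0.
have L2H : L2 *m H = H2 by rewrite mul_row_col mul1mx mul0mx add0r.
have uP1 : P1 \in unitmx.
  by apply: posdef_unitmx; have := posdef_congr fL1 hP; rewrite trmxK L1P.
have uP2 : P2 \in unitmx.
  by apply: posdef_unitmx; have := posdef_congr fL2 hP; rewrite trmxK L2P.
split=> //; exists (best_gain H Pjoint), (invmx (information H Pjoint)).
split=> //.
- split=> // M [inM minM].
  by apply: loewner_le_anti; [apply: min_P.2|apply: minM; exact: min_P.1].
- by rewrite best_gain_unbiased // best_gain_cov //; exact: hP.1.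
- by rewrite unitmx_inv.
- rewrite invmxK; split.
  + by have := information_compression_le H fL1 hP; rewrite L1P L1H.
  + by have := information_compression_le H fL2 hP; rewrite L2P L2H.
Qed.
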